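(* Let $g$ be a coupling function such that the globally coupled system of $N$ phase oscillators $$\frac{d\theta_i}{dt}=\omega+\frac1N\sum_{j=1}^N g(\theta_i-\theta_j),\qquad i=1,\dots,N,$$ has a periodic $M$-cluster state with relative phases $(\psi_1,\dots,\psi_M)$ and nontrivial clusters of sizes $m_1,\dots,m_M$, and suppose that this state is tangentially stable. Then for every $\varepsilon>0$ there exist a parametrized family of coupling functions $$g_r(\varphi)=g(\varphi)+r\,h(\varphi),\qquad r\in\mathbb{R},$$ with $h$ a coupling function, and parameter values $r_1\le\cdots\le r_M$, such that for every $r\in\mathbb{R}$ the system with coupling function $g_r$ has a periodic $M$-cluster state with the same partition and with relative phases $(\psi_1^{(r)},\dots,\psi_M^{(r)})$ satisfying $d(\psi_k^{(r)},\psi_k)<\varepsilon$ for all $k$ (a nearby cluster state), this state is tangentially stable, and moreover: (1) if $r<r_1$, then all of its clusters are unstable; (2) if $r_k<r<r_{k+1}$ for some $1\le k\le M-1$, then precisely $k$ of its clusters are stable; (3) if $r_M<r$, then all of its clusters are stable.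
   Context: Here $\mathbb{T}=[0,2\pi)$ is the circle of phases (taken mod $2\pi$), $\theta_i\in\mathbb{T}$, $\omega\in\mathbb{R}$ is a constant, $d(\phi,\psi)=1-\cos(\phi-\psi)$ measures distance on the circle, and a coupling function is a smooth $2\pi$-periodic function $\mathbb{T}\to\mathbb{R}$. A periodic $M$-cluster state (for coupling function $g$) is given by a partition of $\{1,\dots,N\}$ into $M$ clusters $p_1,\dots,p_M$ with $|p_k|=m_k$, pairwise distinct relative phases $\psi_1,\dots,\psi_M\in\mathbb{T}$ and a frequency $\Omega>0$ such that $\theta_i(t)=\psi_k+\Omega t$ for all $i\in p_k$ solves the system; that is, $\Omega=\omega+\frac1N\sum_{\ell=1}^M m_\ell\, g(\psi_k-\psi_\ell)$ for $k=1,\dots,M$. A cluster $p_k$ is nontrivial if $m_k>1$. Notation: $g'_0=g'(0)$ and, for $k\ne\ell$, $g'_{k\ell}=g'(\psi_k-\psi_\ell)$. Tangential stability: perturbations preserving the clustering satisfy, to first order, $\frac{d\chi_k}{dt}=\frac1N\sum_{\ell=1}^M m_\ell\, g'(\psi_k-\psi_\ell)(\chi_k-\chi_\ell)=\sum_{\ell=1}^MT_{k\ell}\chi_\ell$, i.e. $T_{kk}=\frac1N\sum_{r\neq k}m_r g'_{kr}$ and $T_{k\ell}=-\frac1N m_\ell g'_{k\ell}$ for $\ell\ne k$. The $M\times M$ matrix $T$ always has one trivial eigenvalue $0$ (eigenvector $(1,\dots,1)$). The state is tangentially stable if all the other $M-1$ eigenvalues of $T$ (counted with multiplicity) have negative real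 parts. Stability of a cluster: the transverse exponent of the $k$th cluster (the eigenvalue, of multiplicity $m_k-1$, of the linearization of the system about the state in the co-rotating frame for perturbations that split cluster $k$) is $$\lambda_k^{tran}=\frac1N\Big[m_kg'_0+\sum_{\ell=1,\ell\ne k}^M m_\ell g'_{k\ell}\Big].$$ The $k$th cluster is called stable if $\lambda_k^{tran}<0$ and unstable if $\lambda_k^{tran}>0$. For the system with coupling function $g_r$, these notions are computed with $g_r$ in place of $g$ and at the phases of the state considered. *)

(* Defs.v *)
From HB Require Import structures.
From mathcomp Require Import all_boot all_order all_algebra.
From mathcomp Require Import all_classical all_reals all_analysis.
From mathcomp Require Import complex.

Set Implicit Arguments.
Unset Strict Implicit.
Unset Printing Implicit Defensive.

Import Order.TTheory GRing.Theory Num.Theory.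
Import numFieldNormedType.Exports.

Local Open Scope ring_scope.

Section PhaseOscillators.
Variable R : realType.
Implicit Types (g : R -> R) (x y : R).

(* The circle [0, 2 pi) is represented by its canonical representatives in R,
   and functions on the circle by 2 pi-periodic functions on R.  Smooth means
   C^oo: every iterated derivative is again differentiable everywhere. *)
Definition coupling_function g : Prop :=
  periodic g (pi *+ 2) /\
  forall (n : nat) (x : R), derivable (derive1n n g) x 1.

Definition phase x : bool := (0 <= x) && (x < pi *+ 2).

Definition circle_dist x y : R := 1 - cos (x - y).

Definition solves (N : nat) (omega : R) g (theta : 'I_N -> R -> R) : Prop :=
  forall (i : 'I_N) (t : R),
    is_derive t (1 : R) (theta i)
      (omega + N%:R^-1 * \sum_(j < N) g (theta i t - theta j t)).

(* [finset.partition] requires nonempty blocks; injectivity of [p] makes the M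
   blocks pairwise distinct. *)
Definition clustering (N M : nat) (p : 'I_M -> {set 'I_N}) : Prop :=
  injective p /\
  finset.partition [set p k | k in [set: 'I_M]]%SET [set: 'I_N]%SET.

Record cluster_state (N M : nat) (omega : R) g (p : 'I_M -> {set 'I_N})
    (psi : 'I_M -> R) (Omega : R) : Prop := ClusterState {
  cluster_clustering : clustering p ;
  cluster_phase : forall k, phase (psi k) ;
  cluster_phase_inj : injective psi ;
  cluster_freq_gt0 : 0 < Omega ;
  cluster_solution : exists theta : 'I_N -> R -> R,
    solves omega g theta /\
    forall (k : 'I_M) (i : 'I_N), i \in p k ->
      forall t : R, theta i t = psi k + Omega * t }.

Definition tangential_matrix (N M : nat) g (p : 'I_M -> {set 'I_N})
    (psi : 'I_M -> R) : 'M[R]_M :=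
  \matrix_(k, l)
    if k == l then
      N%:R^-1 * \sum_(r < M | r != k) #|p r|%:R * derive1 g (psi k - psi r)
    else - (N%:R^-1 * (#|p l|%:R * derive1 g (psi k - psi l))).

(* The factor 'X accounts for one copy of the trivial eigenvalue 0; [s] lists
   the remaining complex eigenvalues with their algebraic multiplicities. *)
Definition tangentially_stable (N M : nat) g (p : 'I_M -> {set 'I_N})
    (psi : 'I_M -> R) : Prop :=
  exists s : seq R[i],
    char_poly (map_mx (real_complex R) (tangential_matrix g p psi)) =
      'X * \prod_(z <- s) ('X - z%:P) /\
    forall z : R[i], z \in s -> complex.Re z < 0.

Definition transverse_exponent (N M : nat) g (p : 'I_M -> {set 'I_N})
    (psi : 'I_M -> R) (k : 'I_M) : R :=
  N%:R^-1 * (#|p k|%:R * derive1 g 0 +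
    \sum_(l < M | l != k) #|p l|%:R * derive1 g (psi k - psi l)).

Definition cluster_stable (N M : nat) g (p : 'I_M -> {set 'I_N})
    (psi : 'I_M -> R) (k : 'I_M) : bool :=
  transverse_exponent g p psi k < 0.

Definition cluster_unstable (N M : nat) g (p : 'I_M -> {set 'I_N})
    (psi : 'I_M -> R) (k : 'I_M) : bool :=
  0 < transverse_exponent g p psi k.

End PhaseOscillators.

(* Main.v *)
(* Only the transverse exponents of the clusters involve g'(0).  Take h a
   trigonometric polynomial vanishing to second order at all psi_k - psi_l
   (k <> l), with h(0) = 0 and h'(0) = -1: the same phases and frequency remain a
   cluster state of g + r h for every r, the tangential matrix is unchanged, and
   the k-th transverse exponent becomes lambda_k - r m_k / N.  Hence cluster k is
   stable exactly when r > N lambda_k / m_k, and the parameters r_1 <= ... <= r_M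
   are these thresholds in increasing order. *)
Require Import Defs.
From HB Require Import structures.
From mathcomp Require Import all_boot all_order all_algebra.
From mathcomp Require Import all_classical all_reals all_analysis.
From mathcomp Require Import complex.
From mathcomp Require Import ring lra.
Import Order.TTheory GRing.Theory Num.Theory.
Import numFieldNormedType.Exports.
Local Open Scope ring_scope.

Section Interpolation.
Context {R : realType}.
Implicit Types (f h : R -> R) (a c x : R).

(** An inductive closure, so that smoothness and periodicity follow by induction: the class is
    stable under differentiation and its generators are [pi *+ 2]-periodic. Signs and scalars enter
    as constant factors. *)
Inductive trig_poly : (R -> R) -> Prop :=
| trig_poly_cst c : trig_poly (fun _ => c)
| trig_poly_sin : trig_poly sin
| trig_poly_cos : trig_poly cos
| trig_polyD f h : trig_poly f -> trig_poly h -> trig_poly (fun x => f x + h x)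
| trig_polyM f h : trig_poly f -> trig_poly h -> trig_poly (fun x => f x * h x).

Lemma trig_poly_derive {f} : trig_poly f ->
  exists2 f', trig_poly f' & forall x, is_derive x (1 : R) f (f' x).
Proof.
elim=> [c|||f1 f2 Pf1 [d1 Pd1 D1] Pf2 [d2 Pd2 D2]
         |f1 f2 Pf1 [d1 Pd1 D1] Pf2 [d2 Pd2 D2]].
- by exists (fun=> 0) => [|x]; [exact: trig_poly_cst|exact: is_derive_cst].
- by exists cos => [|x]; [exact: trig_poly_cos|exact: is_derive_sin].
- exists (fun x => -1 * sin x) => [|x].
    by apply: trig_polyM; [exact: trig_poly_cst|exact: trig_poly_sin].
  by rewrite mulN1r; exact: is_derive_cos.
- by exists (fun x => d1 x + d2 x) => [|x]; [exact: trig_polyD|exact: is_deriveD].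
- exists (fun x => f1 x * d2 x + f2 x * d1 x) => [|x].
    by apply: trig_polyD; apply: trig_polyM.
  exact: is_deriveM.
Qed.

Lemma derivable_trig_poly {f} x : trig_poly f -> derivable f x 1.
Proof. by case/trig_poly_derive => f' _ /(_ x)[]. Qed.

Lemma derive1_trig_poly {f} : trig_poly f -> trig_poly (derive1 f).
Proof.
case/trig_poly_derive => f' Pf' Df'; suff -> : derive1 f = f' by [].
by apply/funext => x; rewrite derive1E; exact: derive_val.
Qed.

Lemma trig_poly_coupling {f} : trig_poly f -> coupling_function f.
Proof.
move=> Pf; split; last first.
  move=> n x; suff : trig_poly (derive1n n f) by exact: derivable_trig_poly.
  by elim: n => // n; rewrite derive1nS; exact: derive1_trig_poly.
elim: Pf => [//|||f1 f2 _ P1 _ P2 x|f1 f2 _ P1 _ P2 x].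
- exact: sinD2pi.
- exact: cosD2pi.
- by rewrite P1 P2.
- by rewrite P1 P2.
Qed.

(** Take the product over b in [s] of (1 - cos (x - b)) / (1 - cos b): each factor is 1 at 0 and
    vanishes at b, and the hypothesis keeps the denominators nonzero. *)
Lemma trig_poly_vanishing {s : seq R} : (forall a, a \in s -> cos a != 1) ->
  exists q, [/\ trig_poly q, q 0 = 1 & forall a, a \in s -> q a = 0].
Proof.
elim: s => [_|b s IHs s_neq1].
  by exists (fun=> 1); split => //; exact: trig_poly_cst.
have [|q [Pq q0 qs]] := IHs.
  by move=> a sa; apply: s_neq1; rewrite inE sa orbT.
(* cos (x - b) is expanded so that the witness is built from the constructors of [trig_poly]. *)
exists (fun x => (1 - cos b)^-1 * (1 + (- cos b * cos x + - sin b * sin x)) * q x).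
split.
- by repeat first [exact: Pq | exact: trig_poly_cst | exact: trig_poly_sin
    | exact: trig_poly_cos | apply: trig_polyM | apply: trig_polyD].
- rewrite q0 cos0 sin0 !mulr1 mulr0 addr0 mulVf // subr_eq0 eq_sym.
  by apply: s_neq1; rewrite mem_head.
- move=> a; rewrite inE => /predU1P[->|/qs ->]; last by rewrite mulr0.
  by rewrite !mulNr -opprD -!expr2 cos2Dsin2 subrr mulr0 mul0r.
Qed.

Lemma coupling_derive0_interpolation {s : seq R} :
    (forall a, a \in s -> cos a != 1) ->
  exists h, [/\ coupling_function h, h 0 = 0, derive1 h 0 = -1
    & forall a, a \in s -> h a = 0 /\ derive1 h a = 0].
Proof.
move=> /trig_poly_vanishing[q [Pq q0 qs]].
have [q' _ Dq] := trig_poly_derive Pq.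
(* Squaring [q] makes every zero in [s] a double one; the factor -sin x gives value 0 and slope -1
   at 0, where [q] is 1. *)
pose h x := -1 * sin x * (q x * q x).
have Dh x : derive1 h x = - (sin x * (q x * q' x + q x * q' x) + q x * q x * cos x).
  rewrite derive1E; apply: derive_val.
  have -> : h = - (sin * (q * q)) by apply/funext => y; rewrite /h mulN1r mulNr.
  exact: is_deriveN (is_deriveM (is_derive_sin x) (is_deriveM (Dq x) (Dq x))).
exists h; split.
- by apply: trig_poly_coupling; repeat first [exact: Pq | exact: trig_poly_cst
    | exact: trig_poly_sin | apply: trig_polyM].
- by rewrite /h sin0 mulr0 mul0r.
- by rewrite Dh q0 sin0 cos0 mul0r add0r !mulr1.
- by move=> a /qs qa; rewrite Dh /h qa !(mul0r, mulr0, addr0) oppr0.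
Qed.

(** Half-angle formula: 1 - cos x = 2 sin^2 (|x| / 2), and |x| / 2 lies strictly between 0 and pi,
    where the sine is positive. *)
Lemma cos_neq1 {x} : x != 0 -> `|x| < pi *+ 2 -> cos x != 1.
Proof.
move=> x0 x2pi; rewrite -cos_norm [`|x|](_ : _ = (`|x| / 2) *+ 2); last first.
  by rewrite -mulr_natr divfK ?pnatr_eq0.
have sin_gt0 : 0 < sin (`|x| / 2).
  apply: sin_gt0_pi; rewrite divr_gt0 ?normr_gt0 //=.
  by rewrite ltr_pdivrMr // mulr_natr.
rewrite cos_mulr2n cos2sin2; apply: contraTneq sin_gt0 => E.
suff /eqP : sin (`|x| / 2) ^+ 2 = 0 by rewrite expf_eq0 => /eqP ->; rewrite ltxx.
by lra.
Qed.

Lemma phase_cos_neq1 {x y} : phase x -> phase y -> x != y -> cos (x - y) != 1.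
Proof.
move=> /andP[x0 x2] /andP[y0 y2] xy; apply: cos_neq1; first by rewrite subr_eq0.
by rewrite ltr_norml; apply/andP; split; lra.
Qed.

Lemma derive1_addZ g h r x : derivable g x 1 -> derivable h x 1 ->
  derive1 (fun y => g y + r * h y) x = derive1 g x + r * derive1 h x.
Proof.
move=> dg dh; rewrite !derive1E.
rewrite (_ : (fun y => _) = g + r \*: h) //.
rewrite deriveD ?deriveZ //; exact: derivableZ.
Qed.

End Interpolation.

(** By sortedness the entries below [r] are exactly those at indices 0 to [k]. *)
Lemma sorted_count_lt_eq {d} {T : orderType d} (x0 : T) {r : T} {s : seq T} {k : nat} :
    sorted <=%O s -> (k.+1 < size s)%N ->
    (nth x0 s k < r)%O -> (r < nth x0 s k.+1)%O ->
  count (< r)%O s = k.+1.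
Proof.
move=> s_sorted ks lt_k gt_k; apply/eqP; rewrite eqn_leq; apply/andP; split.
  rewrite leqNgt; apply: contraTN gt_k => /(nth_count_lt x0 s_sorted) lt.
  by rewrite -leNgt ltW.
rewrite ltnNge; apply: contraTN lt_k => le_k; rewrite -leNgt.
by apply: nth_count_ge => //; rewrite le_k ltnW.
Qed.

Theorem theorem6 (R : realType) (N M : nat) (N_gt0 : (0 < N)%N)
    (omega : R) (g : R -> R) (p : 'I_M -> {set 'I_N})
    (psi : 'I_M -> R) (Omega : R)
    (g_coupling : coupling_function g)
    (g_state : cluster_state omega g p psi Omega)
    (p_nontrivial : forall k : 'I_M, (1 < #|p k|)%N)
    (g_tstable : tangentially_stable g p psi)
    (eps : R) (eps_gt0 : 0 < eps) :
  exists (h : R -> R) (rho : nat -> R),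
    let G (r : R) := fun phi : R => g phi + r * h phi in
    coupling_function h /\
    (forall k : nat, (1 <= k)%N -> (k < M)%N -> rho k <= rho k.+1) /\
    forall r : R, exists (psi_r : 'I_M -> R) (Omega_r : R),
      cluster_state omega (G r) p psi_r Omega_r /\
      (forall k : 'I_M, circle_dist (psi_r k) (psi k) < eps) /\
      tangentially_stable (G r) p psi_r /\
      (r < rho 1%N -> forall k : 'I_M, cluster_unstable (G r) p psi_r k) /\
      (forall k : nat, (1 <= k)%N -> (k < M)%N ->
         rho k < r -> r < rho k.+1 ->
         #|[set j : 'I_M | cluster_stable (G r) p psi_r j]%SET| = k) /\
      (rho M < r -> forall k : 'I_M, cluster_stable (G r) p psi_r k).
Proof.
have [p_inj p_part] := cluster_clustering g_state.
have psi_ph := cluster_phase g_state.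
have psi_inj := cluster_phase_inj g_state.
have N0 : (0 : R) < N%:R by rewrite ltr0n.
have m0 k : (0 : R) < #|p k|%:R by rewrite ltr0n ltnW.
pose diffs := [seq psi kl.1 - psi kl.2 | kl <- enum {: 'I_M * 'I_M} & kl.1 != kl.2].
have diffsP k l : k != l -> psi k - psi l \in diffs.
  by move=> kl; apply/mapP; exists (k, l) => //; rewrite mem_filter kl mem_enum.
have [a /mapP[[k l]]|h [h_coupling h0 dh0 h_diffs]] :=
    @coupling_derive0_interpolation R diffs.
  rewrite mem_filter => /andP[/= kl _] ->; apply: phase_cos_neq1 => //.
  by rewrite (inj_eq psi_inj).
(* The diagonal case is covered by [h 0 = 0]. *)
have h_psi k l : h (psi k - psi l) = 0.
  by case: (eqVneq k l) => [->|/diffsP/h_diffs[]//]; rewrite subrr.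
(* The value of [r] at which the transverse exponent of cluster [k] changes sign. *)
pose thr k := N%:R * transverse_exponent g p psi k / #|p k|%:R.
pose s := sort <=%O [seq thr k | k : 'I_M].
have s_sorted : sorted <=%O s by exact: sort_le_sorted.
have s_size : size s = M by rewrite size_sort size_map size_enum_ord.
have thr_s k : exists2 i, (i < M)%N & thr k = nth 0 s i.
  have sk : thr k \in s by rewrite mem_sort map_f ?mem_enum.
  by exists (index (thr k) s); rewrite ?nth_index // -s_size index_mem.
(* Thresholds are numbered from 1 but list entries from 0; for k from 1 to [M] the index is in
   range, so the default 0 is not reached. *)
exists h, (fun k => nth 0 s k.-1) => G; split=> //; split.
  move=> [//|k] _ kM /=.
  by apply: le_sorted_leq_nth => //; rewrite inE s_size // ltnW.
move=> r.
have dG x : derive1 (G r) x = derive1 g x + r * derive1 h x.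
  by apply: derive1_addZ; [exact: (g_coupling.2 0%N)|exact: (h_coupling.2 0%N)].
have dG_diff k l : k != l -> derive1 (G r) (psi k - psi l) = derive1 g (psi k - psi l).
  by move=> /diffsP/h_diffs[_ dh]; rewrite dG dh mulr0 addr0.
have tranE k : transverse_exponent (G r) p psi k = #|p k|%:R / N%:R * (thr k - r).
  transitivity (transverse_exponent g p psi k - #|p k|%:R / N%:R * r).
    rewrite /transverse_exponent dG dh0.
    under eq_bigr => l lk do rewrite dG_diff 1?eq_sym //.
    ring.
  rewrite /thr; field.
  by rewrite !gt_eqF.
have mN k : 0 < #|p k|%:R / N%:R :> R by rewrite divr_gt0.
have stableE k : cluster_stable (G r) p psi k = (thr k < r).
  by rewrite /cluster_stable tranE pmulr_rlt0 // subr_lt0.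
exists psi, Omega; split.
  case: g_state => clus ph inj Om [theta [sol thetaE]]; split=> //.
  exists theta; split=> // i t.
  have cover j : exists k, j \in p k.
    have : j \in finset.cover [set p k | k in [set: 'I_M]]%SET.
      by rewrite (cover_partition p_part) inE.
    by case/bigcupP => A /imsetP[k _ ->] jk; exists k.
  rewrite (eq_bigr (fun j => g (theta i t - theta j t))); first exact: sol.
  (* The common drift [Omega * t] cancels in phase differences, so [h] is evaluated only at
     differences of cluster phases, where it vanishes. *)
  move=> j _; have [k ik] := cover i; have [l jl] := cover j.
  rewrite /G (thetaE k i ik) (thetaE l j jl).
  by rewrite opprD addrACA subrr addr0 h_psi mulr0 addr0.
split; first by move=> k; rewrite /circle_dist subrr cos0 subrr.
split.
  suff : tangential_matrix (G r) p psi = tangential_matrix g p psi.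
    by rewrite /tangentially_stable => ->.
  (* Diagonal entries, too, involve only differences of distinct phases, never the derivative at
     0. *)
  apply/matrixP => k l; rewrite !mxE; case: ifPn => [_|kl]; last by rewrite dG_diff.
  by congr (_ * _); apply: eq_bigr => i ik; rewrite dG_diff // eq_sym.
split=> [r_lt k|].
  rewrite /cluster_unstable tranE pmulr_rgt0 // subr_gt0.
  have [i iM ->] := thr_s k; apply: lt_le_trans r_lt _.
  by apply: le_sorted_leq_nth => //; rewrite inE s_size // (leq_ltn_trans _ iM).
split=> [[//|k] _ kM lt_r gt_r|lt_r k].
  (* Stable clusters correspond to thresholds below [r], and sorting does not change their count. *)
  have <- : count (< r) s = k.+1.
    by apply: (sorted_count_lt_eq 0) => //; rewrite s_size.
  rewrite count_sort count_map cardE size_filter -enumT.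
  by apply: eq_count => k' /=; rewrite inE stableE.
rewrite stableE; have [i iM ->] := thr_s k; apply: le_lt_trans lt_r.
(* Since [M] is positive, [M.-1] is the last index of [s], that of the largest threshold. *)
have M_gt0 : (0 < M)%N by exact: leq_ltn_trans iM.
apply: le_sorted_leq_nth => //; rewrite ?inE ?s_size ?prednK //.
by rewrite -ltnS prednK.
Qed.
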